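(* Girard's call-by-name translation $(\cdot)^{\circ}$ is a simplification from inside of the inner full Girard translation $(\cdot)^{{\rm Gf}_i}$ (as translations from $\mathsf{IL}_{\rm b}$ to $\mathsf{ILL}$): for any formula $A$ of the language of $\mathsf{ILL}$, one obtains $A^{\circ}$ from $A^{{\rm Gf}_i}$ by systematically applying the following formula reductions, starting from the atomic formulas and inductively applying them to composite formulas: $$!(!A\,\&\,!B)\mapsto\,!(A\,\&\,B),\qquad !(!A\multimap\,!B)\mapsto\,!(!A\multimap B),\qquad !\forall x\,!A\mapsto\,!\forall x\,A,\qquad !!!A\mapsto\,!!A.$$ Moreover, the reductions above are reversible in $\mathsf{ILL}$ (i.e. the two sides of each reduction are provably equivalent in $\mathsf{ILL}$).
   Context: Intuitionistic linear logic $\mathsf{ILL}$ (first order). Formulas are built from atomic formulas, including the constants $1,\top,0$, using $\otimes,\&,\oplus,\multimap$, $\forall x,\exists x$ and $!$. Sequents are $\Gamma\vdash A$ with $\Gamma$ a finite multiset of formulas and exactly one formula on the right. Axioms: $A\vdash A$; $\vdash 1$; $\Gamma\vdash\top$; $\Gamma,0\vdash C$. Rules (premises $\Rightarrow$ conclusion): (cut) $\Gamma\vdash A;\ \Delta,A\vdash C\Rightarrow\Gamma,\Delta\vdash C$; $\Gamma\vdash C\Rightarrow\Gamma,1\vdash C$; $\Gamma\vdash A;\ \Delta\vdash B\Rightarrow\Gamma,\Delta\vdash A\otimes B$; $\Gamma,A,B\vdash C\Rightarrow\Gamma,A\otimes B\vdash C$; $\Gamma,A\vdash B\Rightarrow\Gamma\vdash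 A\multimap B$; $\Gamma\vdash A;\ \Delta,B\vdash C\Rightarrow\Gamma,\Delta,A\multimap B\vdash C$; $\Gamma\vdash A;\ \Gamma\vdash B\Rightarrow\Gamma\vdash A\& B$; $\Gamma,A\vdash C\Rightarrow\Gamma,A\& B\vdash C$; $\Gamma,B\vdash C\Rightarrow\Gamma,A\& B\vdash C$; $\Gamma\vdash A\Rightarrow\Gamma\vdash A\oplus B$; $\Gamma\vdash B\Rightarrow\Gamma\vdash A\oplus B$; $\Gamma,A\vdash C;\ \Gamma,B\vdash C\Rightarrow\Gamma,A\oplus B\vdash C$; $\Gamma\vdash A\Rightarrow\Gamma\vdash\forall xA$; $\Gamma,A[t/x]\vdash C\Rightarrow\Gamma,\forall xA\vdash C$; $\Gamma\vdash A[t/x]\Rightarrow\Gamma\vdash\exists xA$; $\Gamma,A\vdash C\Rightarrow\Gamma,\exists xA\vdash C$ (usual eigenvariable conditions); $\Gamma,!A,!A\vdash C\Rightarrow\Gamma,!A\vdash C$; $\Gamma\vdash C\Rightarrow\Gamma,!A\vdash C$; $!\Gamma\vdash A\Rightarrow\,!\Gamma\vdash\,!A$; $\Gamma,A\vdash C\Rightarrow\Gamma,!A\vdash C$. $\mathsf{PRO}$ is the axiom schema $A\vdash\,!A$; $\mathsf{IL}_{\rm b}:=\mathsf{ILL}+\mathsf{PRO}$. Formulas $A,B$ are equivalent over $S$ if $S$ proves $(A\multimap B)\&(B\multimap A)$. Translations. Throughout $\square\in\{\otimes,\&,\oplus,\multimap\}$, $Q\in\{\forall x,\exists x,!\}$.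 Inner full Girard: $A^{{\rm Gf}_i}:=\,!A_{{\rm Gf}_i}$ where $P_{{\rm Gf}_i}:=P$ ($P$ atomic), $(A\,\square\,B)_{{\rm Gf}_i}:=\,!A_{{\rm Gf}_i}\,\square\,!B_{{\rm Gf}_i}$, $(QA)_{{\rm Gf}_i}:=Q\,!A_{{\rm Gf}_i}$. Call-by-name: $A^\circ:=\,!A_\circ$ where $P_\circ:=P$ ($P$ atomic); $(A\otimes B)_\circ:=\,!A_\circ\otimes\,!B_\circ$; $(A\& B)_\circ:=A_\circ\& B_\circ$; $(A\oplus B)_\circ:=\,!A_\circ\oplus\,!B_\circ$; $(A\multimap B)_\circ:=\,!A_\circ\multimap B_\circ$; $(\forall xA)_\circ:=\forall xA_\circ$; $(\exists xA)_\circ:=\exists x\,!A_\circ$; $(!A)_\circ:=\,!A_\circ$. General notions, for a formula construct $T$ (here $T(A)=\,!A$). A $T$-based inner-transform is $\mathcal T_\square(A,B)=T'(A)\,\square\,T''(B)$, resp. $\mathcal T_Q(A)=Q(T'(A))$, with $T',T''\in\{T,\mathrm{Id}\}$. A modular inner $T$-translation is one of the form $A^{\rm Tr}:=T(A_{\rm Tr})$ with $P_{\rm Tr}:=P$ ($P$ atomic), $(A\,\square\,B)_{\rm Tr}:=\mathcal T^{\rm Tr}_\square(A_{\rm Tr},B_{\rm Tr})$, $(QA)_{\rm Tr}:=\mathcal T^{\rm Tr}_Q(A_{\rm Tr})$ for inner-transforms $\mathcal T^{\rm Tr}$. A transform is simpler than another one for the same connective, quantifier or modality if the latter uses $T$ in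 all places where the former does, but not conversely. A translation is sound from $S_1$ to $S_2$ if for all $A$: $\vdash_{S_1}A$ implies $\vdash_{S_2}A^{\rm Tr}$, and $A$, $A^{\rm Tr}$ are equivalent over $S_1$. Two sound translations from $S_1$ to $S_2$ are equivalent if $A^{\rm Tr}$ and $A^{{\rm Tr}'}$ are equivalent over $S_2$ for all $A$. For equivalent translations, ${\rm Tr}'$ is a simplification of ${\rm Tr}$ if each transform of ${\rm Tr}'$ is identical to or simpler than the corresponding one of ${\rm Tr}$, and simpler in at least one case. For two equivalent modular inner $T$-translations, ${\rm Tr}'$ is a simplification from inside of ${\rm Tr}$ if it is a simplification of ${\rm Tr}$ and $A^{{\rm Tr}'}$ is obtained from $A^{\rm Tr}$ by applying the reductions $T(\mathcal T^{\rm Tr}_\square(A,B))\mapsto T(\mathcal T^{{\rm Tr}'}_\square(A,B))$ and $T(\mathcal T^{\rm Tr}_Q(A))\mapsto T(\mathcal T^{{\rm Tr}'}_Q(A))$ inductively, starting from the atomic formulas and working towards the whole formula (first reducing the parts that are translations of the immediate subformulas, then applying the reduction matching the resulting whole formula, if there is one). *)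

(* Defs.v *)
From Stdlib Require Import List Permutation.
From Stdlib Require Vector.
Import ListNotations.

Set Implicit Arguments.
Unset Strict Implicit.
Unset Printing Implicit Defensive.

Record signature : Type := Signature {
  fsym : Type;
  farity : fsym -> nat;
  psym : Type;
  parity : psym -> nat
}.

Inductive binop : Set := Tensor | With | Plus | Lolli.
Inductive unop : Set := All | Ex | OfCourse.

Section Syntax.
Context {Sg : signature}.

(* Variables are de Bruijn indices; [All] and [Ex] bind index 0. *)
Inductive term : Type :=
| Var (n : nat)
| Fun (f : fsym Sg) (ts : Vector.t term (farity f)).

Inductive atomic : Type :=
| Pred (p : psym Sg) (ts : Vector.t term (parity p))
| One
| Top
| Zero.

Inductive form : Type :=
| Atom (P : atomic)
| Bin (o : binop) (A B : form)
| Un (q : unop) (A : form).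

Fixpoint subst_term (s : nat -> term) (t : term) : term :=
  match t with
  | Var n => s n
  | Fun ts => Fun (Vector.map (subst_term s) ts)
  end.

Definition up (s : nat -> term) (n : nat) : term :=
  match n with
  | 0 => Var 0
  | S m => subst_term (fun k => Var (S k)) (s m)
  end.

Definition subst_atomic (s : nat -> term) (P : atomic) : atomic :=
  match P with
  | Pred ts => Pred (Vector.map (subst_term s) ts)
  | One => One
  | Top => Top
  | Zero => Zero
  end.

Fixpoint subst (s : nat -> term) (A : form) : form :=
  match A with
  | Atom P => Atom (subst_atomic s P)
  | Bin o A B => Bin o (subst s A) (subst s B)
  | Un OfCourse A => Un OfCourse (subst s A)
  | Un q A => Un q (subst (up s) A)
  end.

Definition shift (A : form) : form := subst (fun n => Var (S n)) A.

(* [A[t/x]] for the variable [x] bound by the quantifier whose body is [A]. *)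
Definition inst (t : term) (A : form) : form :=
  subst (fun n => match n with 0 => t | S m => Var m end) A.

End Syntax.

Arguments term Sg : clear implicits.
Arguments atomic Sg : clear implicits.
Arguments form Sg : clear implicits.

Notation Bang := (Un OfCourse).

Section Calculus.
Context {Sg : signature}.
Implicit Types (A B C : form Sg) (G D : list (form Sg)).

(* Sequent calculus of intuitionistic linear logic extended by the axioms
   [A |- B] for [ax A B].  Contexts are multisets: lists up to [Permutation].
   The eigenvariable conditions are expressed by shifting the side formulas. *)
Inductive derivable (ax : form Sg -> form Sg -> Prop) :
    list (form Sg) -> form Sg -> Prop :=
| d_ax A B : ax A B -> derivable ax [A] B
| d_exch G D C : Permutation G D -> derivable ax G C -> derivable ax D C
| d_id A : derivable ax [A] A
| d_oneR : derivable ax [] (Atom One)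
| d_topR G : derivable ax G (Atom Top)
| d_zeroL G C : derivable ax (Atom Zero :: G) C
| d_cut G D A C :
    derivable ax G A -> derivable ax (A :: D) C -> derivable ax (G ++ D) C
| d_oneL G C : derivable ax G C -> derivable ax (Atom One :: G) C
| d_tensorR G D A B :
    derivable ax G A -> derivable ax D B ->
    derivable ax (G ++ D) (Bin Tensor A B)
| d_tensorL G A B C :
    derivable ax (A :: B :: G) C -> derivable ax (Bin Tensor A B :: G) C
| d_lolliR G A B :
    derivable ax (A :: G) B -> derivable ax G (Bin Lolli A B)
| d_lolliL G D A B C :
    derivable ax G A -> derivable ax (B :: D) C ->
    derivable ax (Bin Lolli A B :: G ++ D) C
| d_withR G A B :
    derivable ax G A -> derivable ax G B -> derivable ax G (Bin With A B)
| d_withL1 G A B C :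
    derivable ax (A :: G) C -> derivable ax (Bin With A B :: G) C
| d_withL2 G A B C :
    derivable ax (B :: G) C -> derivable ax (Bin With A B :: G) C
| d_plusR1 G A B : derivable ax G A -> derivable ax G (Bin Plus A B)
| d_plusR2 G A B : derivable ax G B -> derivable ax G (Bin Plus A B)
| d_plusL G A B C :
    derivable ax (A :: G) C -> derivable ax (B :: G) C ->
    derivable ax (Bin Plus A B :: G) C
| d_allR G A : derivable ax (map shift G) A -> derivable ax G (Un All A)
| d_allL G A t C :
    derivable ax (inst t A :: G) C -> derivable ax (Un All A :: G) C
| d_exR G A t : derivable ax G (inst t A) -> derivable ax G (Un Ex A)
| d_exL G A C :
    derivable ax (A :: map shift G) (shift C) -> derivable ax (Un Ex A :: G) C
| d_contr G A C :
    derivable ax (Bang A :: Bang A :: G) C -> derivable ax (Bang A :: G) C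
| d_weak G A C : derivable ax G C -> derivable ax (Bang A :: G) C
| d_prom G A :
    derivable ax (map Bang G) A -> derivable ax (map Bang G) (Bang A)
| d_der G A C : derivable ax (A :: G) C -> derivable ax (Bang A :: G) C.

Definition ILL : list (form Sg) -> form Sg -> Prop :=
  derivable (fun _ _ => False).

Definition PRO (A B : form Sg) : Prop := B = Bang A.

Definition ILb : list (form Sg) -> form Sg -> Prop := derivable PRO.

End Calculus.

Arguments ILL Sg : clear implicits.
Arguments ILb Sg : clear implicits.

Section Translations.
Context {Sg : signature}.
Implicit Types (A B X Y F : form Sg) (L : list (form Sg) -> form Sg -> Prop)
  (Tr : form Sg -> form Sg).

Definition equivalent L A B : Prop :=
  L [] (Bin With (Bin Lolli A B) (Bin Lolli B A)).

Definition sound L1 L2 Tr : Prop :=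
  forall A, (L1 [] A -> L2 [] (Tr A)) /\ equivalent L1 A (Tr A).

Definition equivalent_translations L1 L2 Tr Tr' : Prop :=
  sound L1 L2 Tr /\ sound L1 L2 Tr' /\
  forall A, equivalent L2 (Tr A) (Tr' A).

(* A family of inner-transforms, one for each connective, quantifier and
   modality, given by the choice of [T'] and [T''] in {T, Id}: [true] stands
   for [T] and [false] for the identity. *)
Record transforms : Set := Transforms {
  tbin : binop -> bool * bool;
  tun : unop -> bool
}.

Section Construct.
Variable T : form Sg -> form Sg.

Definition use (b : bool) X : form Sg := if b then T X else X.

Definition transform_bin (tau : transforms) (o : binop) X Y : form Sg :=
  Bin o (use (fst (tbin tau o)) X) (use (snd (tbin tau o)) Y).

Definition transform_un (tau : transforms) (q : unop) X : form Sg :=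
  Un q (use (tun tau q) X).

Fixpoint inner (tau : transforms) (A : form Sg) : form Sg :=
  match A with
  | Atom P => Atom P
  | Bin o A B => transform_bin tau o (inner tau A) (inner tau B)
  | Un q A => transform_un tau q (inner tau A)
  end.

Definition modular_inner (tau : transforms) Tr : Prop :=
  forall A, Tr A = T (inner tau A).

(* The reductions that replace the transforms [tau] by [tau']. *)
Inductive transform_reduction (tau tau' : transforms) :
    form Sg -> form Sg -> Prop :=
| tred_bin o X Y :
    transform_reduction tau tau'
      (T (transform_bin tau o X Y)) (T (transform_bin tau' o X Y))
| tred_un q X :
    transform_reduction tau tau'
      (T (transform_un tau q X)) (T (transform_un tau' q X)).

Definition reduce_root (red : form Sg -> form Sg -> Prop) F F' : Prop :=
  red F F' \/ (F' = F /\ forall H, ~ red F H).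

(* [reduces_from_inside tau red A F F']: the translation [F] of [A], with
   transforms [tau], becomes [F'] when the parts of [F] that translate the
   immediate subformulas of [A] are first reduced in this same way and then the
   reduction in [red] matching the whole resulting formula, if any, is applied.
   The recursion follows [A], because a blind bottom-up traversal of [F] would
   also reduce subformulas that are not translations of subformulas of [A]: for
   [A = !!P] it would collapse [!!!!!P] to [!!P] instead of [!!!P].
   The premises reduce [T X] to [T X'], the argument place itself containing
   [T X] or [X] according to the transform. *)
Inductive reduces_from_inside (tau : transforms)
    (red : form Sg -> form Sg -> Prop) : form Sg -> form Sg -> form Sg -> Prop :=
| rfi_atom P : reduces_from_inside tau red (Atom P) (T (Atom P)) (T (Atom P))
| rfi_bin o A B X X' Y Y' F' :
    reduces_from_inside tau red A (T X) (T X') ->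
    reduces_from_inside tau red B (T Y) (T Y') ->
    reduce_root red (T (transform_bin tau o X' Y')) F' ->
    reduces_from_inside tau red (Bin o A B) (T (transform_bin tau o X Y)) F'
| rfi_un q A X X' F' :
    reduces_from_inside tau red A (T X) (T X') ->
    reduce_root red (T (transform_un tau q X')) F' ->
    reduces_from_inside tau red (Un q A) (T (transform_un tau q X)) F'.

End Construct.

(* [b] uses [T] wherever [b'] does. *)
Definition covers_un (b b' : bool) : Prop := b' = true -> b = true.

Definition covers_bin (p p' : bool * bool) : Prop :=
  covers_un (fst p) (fst p') /\ covers_un (snd p) (snd p').

Definition simpler_un (b' b : bool) : Prop :=
  covers_un b b' /\ ~ covers_un b' b.

Definition simpler_bin (p' p : bool * bool) : Prop :=
  covers_bin p p' /\ ~ covers_bin p' p.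

Definition simpler_transforms (tau' tau : transforms) : Prop :=
  (forall o, tbin tau' o = tbin tau o \/
             simpler_bin (tbin tau' o) (tbin tau o)) /\
  (forall q, tun tau' q = tun tau q \/ simpler_un (tun tau' q) (tun tau q)) /\
  ((exists o, simpler_bin (tbin tau' o) (tbin tau o)) \/
   (exists q, simpler_un (tun tau' q) (tun tau q))).

(* [Tr'] is a simplification from inside of [Tr], both being modular inner
   [T]-translations from [L1] to [L2]. *)
Definition simplification_from_inside (T : form Sg -> form Sg) L1 L2 Tr' Tr :
    Prop :=
  exists tau tau',
    modular_inner T tau Tr /\ modular_inner T tau' Tr' /\
    equivalent_translations L1 L2 Tr Tr' /\
    simpler_transforms tau' tau /\
    forall A, reduces_from_inside T tau (transform_reduction T tau tau')
                A (Tr A) (Tr' A).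

Fixpoint gfi_in (A : form Sg) : form Sg :=
  match A with
  | Atom P => Atom P
  | Bin o A B => Bin o (Bang (gfi_in A)) (Bang (gfi_in B))
  | Un q A => Un q (Bang (gfi_in A))
  end.

Definition gfi (A : form Sg) : form Sg := Bang (gfi_in A).

Fixpoint cbn_in (A : form Sg) : form Sg :=
  match A with
  | Atom P => Atom P
  | Bin Tensor A B => Bin Tensor (Bang (cbn_in A)) (Bang (cbn_in B))
  | Bin With A B => Bin With (cbn_in A) (cbn_in B)
  | Bin Plus A B => Bin Plus (Bang (cbn_in A)) (Bang (cbn_in B))
  | Bin Lolli A B => Bin Lolli (Bang (cbn_in A)) (cbn_in B)
  | Un All A => Un All (cbn_in A)
  | Un Ex A => Un Ex (Bang (cbn_in A))
  | Un OfCourse A => Bang (cbn_in A)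
  end.

Definition cbn (A : form Sg) : form Sg := Bang (cbn_in A).

Inductive cbn_reduction : form Sg -> form Sg -> Prop :=
| cbn_with A B :
    cbn_reduction (Bang (Bin With (Bang A) (Bang B))) (Bang (Bin With A B))
| cbn_lolli A B :
    cbn_reduction (Bang (Bin Lolli (Bang A) (Bang B)))
                  (Bang (Bin Lolli (Bang A) B))
| cbn_all A : cbn_reduction (Bang (Un All (Bang A))) (Bang (Un All A))
| cbn_bang A : cbn_reduction (Bang (Bang (Bang A))) (Bang (Bang A)).

End Translations.

Definition gfi_transforms : transforms :=
  Transforms (fun _ => (true, true)) (fun _ => true).

(* Main.v *)
(** In a sequent whose hypotheses are all banged, every rule of ILL is available
    on its right-hand side under a bang, by promotion.  Hence a derivation in ILb
    turns rule by rule into an ILL-derivation of its inner full Girard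
    translation, the axiom [A |- !A] becoming [!A |- !!!A].  Soundness of
    call-by-name is then transferred along the equivalence in ILL of the two
    translations, which follows from the reversibility of the reductions by
    congruence. *)
From Stdlib Require Import List Permutation.
From Stdlib Require Vector.
Require Import Defs.
Import ListNotations.

Set Implicit Arguments.
Unset Strict Implicit.

(** * De Bruijn substitutions and their commutation with the translation *)

Section Substitution.
Context {Sg : signature}.

Lemma subst_term_cancel (r s : nat -> term Sg) :
  (forall n, subst_term s (r n) = Var n) ->
  forall t, subst_term s (subst_term r t) = t.
Proof.
  intros H.
  (* The generated induction principle of [term] gives no hypothesis for the entries of the vector,
     hence a raw fixpoint with an inner induction on [ts]. *)
  fix IH 1. intros [n | f ts]; simpl.
  - apply H.
  - f_equal. induction ts as [| t k ts IHts]; simpl; [reflexivity |].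
    f_equal; [apply IH | exact IHts].
Qed.

(** Taking [r] to be a renaming lets the hypotheses pass under binders: [up r] is again a renaming,
    along [f] lifted to fix 0, and [up s] inverts it. *)
Lemma subst_cancel (A : form Sg) (f : nat -> nat) (r s : nat -> term Sg) :
  (forall n, r n = Var (f n)) -> (forall n, s (f n) = Var n) ->
  subst s (subst r A) = A.
Proof.
  assert (Hup : forall (f : nat -> nat) (r s : nat -> term Sg),
    (forall n, r n = Var (f n)) -> (forall n, s (f n) = Var n) ->
    let g n := match n with 0 => 0 | S m => S (f m) end in
    (forall n, up r n = Var (g n)) /\ (forall n, up s (g n) = Var n)).
  { intros f' r' s' Hr Hs g.
    split; intros [| n]; simpl; rewrite ?Hr, ?Hs; reflexivity. }
  revert f r s. induction A as [P | o A IHA B IHB | q A IHA]; intros f r s Hr Hs.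
  - destruct P as [p ts | | |]; simpl; try reflexivity.
    do 2 f_equal. rewrite Vector.map_map. rewrite <- (Vector.map_id _ _ ts) at 2.
    apply Vector.map_ext. apply subst_term_cancel.
    intros n. rewrite Hr. apply Hs.
  - simpl. f_equal; [exact (IHA f r s Hr Hs) | exact (IHB f r s Hr Hs)].
  - destruct (Hup f r s Hr Hs) as [Hr' Hs'].
    destruct q; simpl; f_equal;
      [exact (IHA _ _ _ Hr' Hs') | exact (IHA _ _ _ Hr' Hs')
      | exact (IHA f r s Hr Hs)].
Qed.

Lemma inst_var0_subst_up (A : form Sg) :
  inst (Var 0) (subst (up (fun n => Var (S n))) A) = A.
Proof.
  (* The lifted successor fixes 0 and skips index 1; instantiating by [Var 0] sends both 0 and 1 to
     0, and so inverts it. *)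
  apply subst_cancel with (f := fun n => match n with 0 => 0 | S m => S (S m) end);
    intros [| n]; reflexivity.
Qed.

Lemma gfi_in_subst (A : form Sg) (s : nat -> term Sg) :
  gfi_in (subst s A) = subst s (gfi_in A).
Proof.
  revert s. induction A as [P | o A IHA B IHB | [] A IHA]; intros s; simpl;
    rewrite ?IHA, ?IHB; reflexivity.
Qed.

Lemma gfi_subst (A : form Sg) (s : nat -> term Sg) :
  gfi (subst s A) = subst s (gfi A).
Proof. unfold gfi. now rewrite gfi_in_subst. Qed.

Lemma map_gfi_shift (G : list (form Sg)) :
  map gfi (map shift G) = map shift (map gfi G).
Proof. rewrite !map_map. apply map_ext. intros A. apply gfi_subst. Qed.

End Substitution.

(** * Congruence for provable equivalence, and reversibility of the reductions *)

Section Interderivability.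
Context {Sg : signature}.
Variable ax : form Sg -> form Sg -> Prop.
Implicit Types A B C : form Sg.

(** Unlike [equivalent], this form composes directly by cut. The axioms [ax] stay arbitrary so that
    the results serve both [ILL] and [ILb]. *)
Definition interderivable A B : Prop :=
  derivable ax [A] B /\ derivable ax [B] A.

Lemma derivable_trans A B C :
  derivable ax [A] B -> derivable ax [B] C -> derivable ax [A] C.
Proof. intros HAB HBC. exact (d_cut HAB HBC). Qed.

Lemma interderivable_refl A : interderivable A A.
Proof. split; apply d_id. Qed.

Lemma interderivable_trans A B C :
  interderivable A B -> interderivable B C -> interderivable A C.
Proof. intros [? ?] [? ?]. split; eapply derivable_trans; eassumption. Qed.

Lemma interderivable_equivalent A B :
  interderivable A B -> equivalent (derivable ax) A B.
Proof. intros [? ?]. apply d_withR; apply d_lolliR; assumption. Qed.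

Lemma derivable_prom1 A B :
  derivable ax [Bang A] B -> derivable ax [Bang A] (Bang B).
Proof. exact (@d_prom _ ax [A] B). Qed.

Lemma derivable_modus_ponens A B : derivable ax [A; Bin Lolli A B] B.
Proof.
  eapply d_exch; [apply perm_swap |].
  apply (@d_lolliL _ ax [A] []); apply d_id.
Qed.

(** After the shift, index 0 is fresh for the hypothesis and plays the eigenvariable, so
    instantiating with it gives back the body. This fits the premise of [d_allR]. *)
Lemma derivable_all_body A :
  derivable ax [shift (Un All A)] A.
Proof.
  unfold shift; simpl. apply d_allL with (t := Var 0).
  rewrite inst_var0_subst_up. apply d_id.
Qed.

Lemma derivable_ex_body A :
  derivable ax [A] (shift (Un Ex A)).
Proof.
  unfold shift; simpl. apply d_exR with (t := Var 0).
  rewrite inst_var0_subst_up. apply d_id.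
Qed.

(** The converse derivation on the left component serves [Lolli], which is contravariant there. *)
Lemma derivable_bin o A A' B B' :
  derivable ax [A] A' -> derivable ax [A'] A -> derivable ax [B] B' ->
  derivable ax [Bin o A B] (Bin o A' B').
Proof.
  intros HA HA' HB. destruct o.
  - apply d_tensorL. exact (d_tensorR HA HB).
  - apply d_withR; [apply d_withL1 | apply d_withL2]; assumption.
  - apply d_plusL; [apply d_plusR1 | apply d_plusR2]; assumption.
  - apply d_lolliR. eapply d_exch; [apply perm_swap |].
    exact (d_lolliL HA' HB).
Qed.

Lemma derivable_un q A B :
  derivable ax [A] B -> derivable ax [Un q A] (Un q B).
Proof.
  intros H. destruct q.
  - apply d_allR. exact (derivable_trans (derivable_all_body A) H).
  - apply d_exL. exact (derivable_trans H (derivable_ex_body B)).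
  - apply derivable_prom1, d_der, H.
Qed.

Lemma interderivable_bin o A A' B B' :
  interderivable A A' -> interderivable B B' ->
  interderivable (Bin o A B) (Bin o A' B').
Proof. intros [? ?] [? ?]. split; apply derivable_bin; assumption. Qed.

Lemma interderivable_un q A B :
  interderivable A B -> interderivable (Un q A) (Un q B).
Proof. intros [? ?]. split; apply derivable_un; assumption. Qed.

(** From left to right, dereliction drops the inner bang. From right to left, the outer bang of the
    hypothesis permits promotion, which recreates it. *)
Lemma cbn_reduction_interderivable (F F' : form Sg) :
  cbn_reduction F F' -> interderivable F F'.
Proof.
  intros [A B | A B | A | A]; split.
  - apply derivable_un.
    apply d_withR; [apply d_withL1 | apply d_withL2]; apply d_der, d_id.
  - apply derivable_prom1, d_withR; apply derivable_prom1, d_der;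
      [apply d_withL1 | apply d_withL2]; apply d_id.
  - apply derivable_un, d_lolliR.
    apply (@d_cut _ ax [Bang A; Bin Lolli (Bang A) (Bang B)] [] (Bang B));
      [apply derivable_modus_ponens | apply d_der, d_id].
  - apply derivable_prom1, d_lolliR.
    (* The antecedent moved to the left is itself banged, so the whole context still allows
       promotion. *)
    apply (@d_prom _ ax [A; Bin Lolli (Bang A) B]); simpl.
    eapply d_exch; [apply perm_swap |]. apply d_der.
    eapply d_exch; [apply perm_swap |]. apply derivable_modus_ponens.
  - apply derivable_un, derivable_un, d_der, d_id.
  - apply derivable_prom1, d_allR. apply derivable_prom1, d_der.
    apply derivable_all_body.
  - apply d_der, d_id.
  - apply derivable_prom1, d_id.
Qed.

Lemma gfi_cbn_interderivable A : interderivable (gfi A) (cbn A).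
Proof.
  unfold gfi, cbn. induction A as [P | o A IHA B IHB | q A IHA].
  - apply interderivable_refl.
  - eapply interderivable_trans.
    + apply interderivable_un, interderivable_bin; [exact IHA | exact IHB].
    (* For [Tensor] and [Plus] both sides coincide; [With] and [Lolli] take one reduction at the
       root. *)
    + destruct o; try apply interderivable_refl;
        apply cbn_reduction_interderivable; constructor.
  - eapply interderivable_trans.
    + apply interderivable_un, interderivable_un; exact IHA.
    + destruct q; try apply interderivable_refl;
        apply cbn_reduction_interderivable; constructor.
Qed.

End Interderivability.

(** * Soundness of both translations *)

Section Soundness.
Context {Sg : signature}.
Implicit Types (A : form Sg) (G : list (form Sg)).

Lemma ILL_prom_gfi G A : ILL Sg (map gfi G) A -> ILL Sg (map gfi G) (Bang A).
Proof.
  replace (map gfi G) with (map Bang (map gfi_in G))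
    by (rewrite map_map; reflexivity).
  apply d_prom.
Qed.

Lemma ILb_gfi G A : ILb Sg G A -> ILL Sg (map gfi G) (gfi A).
Proof.
  unfold ILb.
  induction 1 as
    [A B Hax | G D C HP _ IH | A | | G | G C | G D A C _ IH1 _ IH2 | G C _ IH
    | G D A B _ IH1 _ IH2 | G A B C _ IH | G A B _ IH | G D A B C _ IH1 _ IH2
    | G A B _ IH1 _ IH2 | G A B C _ IH | G A B C _ IH | G A B _ IH | G A B _ IH
    | G A B C _ IH1 _ IH2 | G A _ IH | G A t C _ IH | G A t _ IH | G A C _ IH
    | G A C _ IH | G A C _ IH | G A _ IH | G A C _ IH].
  - rewrite Hax. apply ILL_prom_gfi, ILL_prom_gfi, d_id.
  - exact (d_exch (Permutation_map gfi HP) IH).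
  - apply d_id.
  - apply (@ILL_prom_gfi []), d_oneR.
  - apply ILL_prom_gfi, d_topR.
  - apply d_der, d_zeroL.
  - rewrite map_app. exact (d_cut IH1 IH2).
  - apply d_weak, IH.
  - apply ILL_prom_gfi. rewrite map_app. exact (d_tensorR IH1 IH2).
  - apply d_der, d_tensorL, IH.
  - apply ILL_prom_gfi, d_lolliR, IH.
  - rewrite map_cons, map_app. exact (d_der (d_lolliL IH1 IH2)).
  - apply ILL_prom_gfi, d_withR; assumption.
  - apply d_der, d_withL1, IH.
  - apply d_der, d_withL2, IH.
  - apply ILL_prom_gfi, d_plusR1, IH.
  - apply ILL_prom_gfi, d_plusR2, IH.
  - apply d_der, d_plusL; assumption.
  (* The eigenvariable condition transfers because the translation commutes with shifting. *)
  - apply ILL_prom_gfi, d_allR. rewrite <- map_gfi_shift. exact IH.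
  - apply d_der, d_allL with (t := t). unfold inst in IH.
    rewrite map_cons, gfi_subst in IH. exact IH.
  - apply ILL_prom_gfi, d_exR with (t := t). unfold inst in IH.
    rewrite gfi_subst in IH. exact IH.
  - apply d_der, d_exL. unfold shift at 2 in IH.
    rewrite map_cons, map_gfi_shift, gfi_subst in IH. exact IH.
  - apply d_contr, IH.
  - apply d_weak, IH.
  (* [gfi (Bang A)] is [gfi A] under two further bangs, hence two promotions here and two
     derelictions in the next case. *)
  - apply ILL_prom_gfi, ILL_prom_gfi, IH.
  - apply d_der, d_der, IH.
Qed.

(** [PRO] is the converse of dereliction, so over [ILb] bangs may be inserted anywhere up to
    interderivability. *)
Lemma ILb_bang A : interderivable PRO A (Bang A).
Proof. split; [now apply d_ax | apply d_der, d_id]. Qed.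

Lemma ILb_gfi_in A : interderivable PRO A (gfi_in A).
Proof.
  induction A as [P | o A IHA B IHB | q A IHA]; simpl.
  - apply interderivable_refl.
  - apply interderivable_bin; eapply interderivable_trans;
      eauto using ILb_bang.
  - apply interderivable_un. eapply interderivable_trans; eauto using ILb_bang.
Qed.

Lemma ILb_gfi_interderivable A : interderivable PRO A (gfi A).
Proof. exact (interderivable_trans (ILb_gfi_in A) (ILb_bang _)). Qed.

Lemma gfi_sound : sound (ILb Sg) (ILL Sg) gfi.
Proof.
  intros A. split.
  - apply (@ILb_gfi []).
  - apply interderivable_equivalent, ILb_gfi_interderivable.
Qed.

Lemma cbn_sound : sound (ILb Sg) (ILL Sg) cbn.
Proof.
  intros A. split.
  - intros HA. exact (d_cut (@ILb_gfi [] A HA) (proj1 (gfi_cbn_interderivable _ A))).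
  - apply interderivable_equivalent.
    exact (interderivable_trans (ILb_gfi_interderivable A)
             (gfi_cbn_interderivable _ A)).
Qed.

End Soundness.

(** * Modularity and reduction from inside *)

Section Reductions.
Context {Sg : signature}.
Implicit Types A : form Sg.

Definition cbn_transforms : transforms :=
  Transforms
    (fun o => match o with
              | Tensor | Plus => (true, true)
              | With => (false, false)
              | Lolli => (true, false)
              end)
    (fun q => match q with Ex => true | All | OfCourse => false end).

Lemma gfi_modular : modular_inner Bang gfi_transforms (@gfi Sg).
Proof.
  intros A. unfold gfi. f_equal.
  induction A as [P | o A IHA B IHB | q A IHA]; simpl;
    rewrite ?IHA, ?IHB; reflexivity.
Qed.

Lemma cbn_modular : modular_inner Bang cbn_transforms (@cbn Sg).
Proof.
  intros A. unfold cbn. f_equal.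
  induction A as [P | [] A IHA B IHB | [] A IHA]; simpl;
    rewrite ?IHA, ?IHB; reflexivity.
Qed.

Lemma cbn_transforms_simpler : simpler_transforms cbn_transforms gfi_transforms.
Proof.
  unfold simpler_transforms, simpler_bin, simpler_un, covers_bin, covers_un.
  repeat split.
  - intros []; simpl; intuition congruence.
  - intros []; simpl; intuition congruence.
  - left. exists With. simpl. intuition congruence.
Qed.

(** [transform_reduction] has a rule for every connective, trivial where the transforms agree, so a
    root step always exists. *)
Lemma inner_reduces (T : form Sg -> form Sg) (tau tau' : transforms) A :
  reduces_from_inside T tau (transform_reduction T tau tau') A
    (T (inner T tau A)) (T (inner T tau' A)).
Proof.
  induction A as [P | o A IHA B IHB | q A IHA]; simpl.
  - apply rfi_atom.
  - eapply rfi_bin; [exact IHA | exact IHB | left; apply tred_bin].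
  - eapply rfi_un; [exact IHA | left; apply tred_un].
Qed.

(** Here only the four listed reductions are available: for [Tensor], [Plus] and [Ex] the root stays
    put, which requires that no rule match it. *)
Lemma gfi_reduces_cbn A :
  reduces_from_inside Bang gfi_transforms cbn_reduction A (gfi A) (cbn A).
Proof.
  unfold gfi, cbn. induction A as [P | o A IHA B IHB | q A IHA].
  - apply rfi_atom.
  - apply (rfi_bin (tau := gfi_transforms) (o := o) IHA IHB).
    destruct o.
    + right. split; [reflexivity | intros H HF; inversion HF].
    + left. apply cbn_with.
    + right. split; [reflexivity | intros H HF; inversion HF].
    + left. apply cbn_lolli.
  - apply (rfi_un (tau := gfi_transforms) (q := q) IHA).
    destruct q.
    + left. apply cbn_all.
    + right. split; [reflexivity | intros H HF; inversion HF].
    + left. apply cbn_bang.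
Qed.

End Reductions.

Theorem proposition10 (Sg : signature) :
  simplification_from_inside Bang (ILb Sg) (ILL Sg) cbn gfi /\
  (forall A : form Sg,
     reduces_from_inside Bang gfi_transforms cbn_reduction A (gfi A) (cbn A)) /\
  (forall F F' : form Sg, cbn_reduction F F' -> equivalent (ILL Sg) F F').
Proof.
  split; [| split].
  - exists gfi_transforms, cbn_transforms.
    split; [apply gfi_modular |]. split; [apply cbn_modular |].
    split.
    + split; [apply gfi_sound |]. split; [apply cbn_sound |].
      intros A. apply interderivable_equivalent, gfi_cbn_interderivable.
    + split; [apply cbn_transforms_simpler |].
      intros A. rewrite gfi_modular, cbn_modular. apply inner_reduces.
  - apply gfi_reduces_cbn.
  - intros F F' HF. apply interderivable_equivalent.
    apply cbn_reduction_interderivable, HF.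
Qed.
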